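(* Let $P$ be the probability measure on $\{1,2,3,4,5,6\}\subset\mathbb{R}$ with probability mass function $f(j)=2^{-j}$ for $j\in\{1,2,3,4,5\}$ and $f(6)=2^{-5}$. The optimal set of four-means for $P$ is $\{1,2,a[3,4],a[5,6]\}$, with quantization error $V_4(P)=\frac{11}{192}$.
   Context: For a Borel probability measure $P$ on $\mathbb{R}$ and a nonempty finite set $\alpha\subset\mathbb{R}$, the distortion error is $V(P;\alpha)=\int\min_{a\in\alpha}|x-a|^2\,dP(x)$. The $n$th quantization error is $V_n(P)=\inf\{V(P;\alpha):\alpha\subset\mathbb{R},\ 1\le\mathrm{card}(\alpha)\le n\}$, and a set $\alpha$ with $1\le\mathrm{card}(\alpha)\le n$ attaining this infimum is called an optimal set of $n$-means for $P$. For $i\le j$ in $\{1,\dots,6\}$, $a[i,j]=\dfrac{\sum_{k=i}^{j}k f(k)}{\sum_{k=i}^{j}f(k)}$. *)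

(* Defs.v *)
From HB Require Import structures.
From mathcomp Require Import all_boot all_order all_algebra finmap.
From mathcomp Require Import all_classical all_reals all_analysis.
From mathcomp Require Import ring lra.

Set Implicit Arguments.
Unset Strict Implicit.
Unset Printing Implicit Defensive.

Import Order.TTheory GRing.Theory Num.Theory.
Import numFieldNormedType.Exports.

Local Open Scope classical_set_scope.
Local Open Scope ring_scope.

Section quantization.
Context {R : realType}.
Implicit Types (P : probability (measurableTypeR R) R) (alpha : {fset R}).

(* The minimum is taken in \bar R with neutral element +oo, so that it is the
   genuine minimum of the squared distances as soon as alpha is nonempty; only
   nonempty sets are used below. *)
Definition sqdist (x : R) alpha : \bar R :=
  \big[Order.min/+oo%E]_(a <- alpha) (`|x - a| ^+ 2)%:E.

Definition distortion P alpha : \bar R := (\int[P]_x sqdist x alpha)%E.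

Definition codebook (n : nat) alpha : Prop := (1 <= #|` alpha| <= n)%N.

Definition quantization_error P (n : nat) : \bar R :=
  ereal_inf [set distortion P alpha | alpha in [set alpha | codebook n alpha]].

Definition optimal_means P (n : nat) alpha : Prop :=
  codebook n alpha /\ distortion P alpha = quantization_error P n.

End quantization.

Definition mass (R : realType) (j : nat) : R :=
  if (1 <= j <= 5)%N then 2 ^- j else if (j == 6)%N then 2 ^- 5 else 0.

Definition cond_mean (R : realType) (i j : nat) : R :=
  (\sum_(i <= k < j.+1) k%:R * mass R k) / \sum_(i <= k < j.+1) mass R k.

Lemma mass_ge0 (R : realType) (j : nat) : 0 <= mass R j.
Proof. by rewrite /mass; do 2?case: ifP => _ //; rewrite invr_ge0 exprn_ge0. Qed.

Section six_point.
Context {R : realType}.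

(* The index i < 6 stands for the atom i.+1. *)
Definition six_point : set (measurableTypeR R) -> \bar R :=
  msum (fun i : nat =>
    mscale (NngNum (mass_ge0 R i.+1)) (@dirac _ (measurableTypeR R) i.+1%:R R)) 6.

HB.instance Definition _ := Measure.on six_point.

Lemma six_pointE (A : set (measurableTypeR R)) :
  six_point A = (\sum_(i < 6) (mass R i.+1)%:E * \d_(i.+1%:R : measurableTypeR R) A)%E.
Proof. by []. Qed.

Lemma six_pointT : six_point setT = 1%E.
Proof.
rewrite six_pointE.
under eq_bigr do rewrite diracT mule1.
rewrite sumEFin; congr (_%:E).
by rewrite !big_ord_recl big_ord0 /mass /=; field.
Qed.

HB.instance Definition _ := Measure_isProbability.Build _ _ _ six_point six_pointT.

Lemma six_point_mass (j : nat) : (1 <= j <= 6)%N ->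
  six_point [set j%:R] = (mass R j)%:E.
Proof.
case: j => // j /= j6; rewrite six_pointE (bigD1 (Ordinal j6)) //=.
rewrite diracE mem_set // mule1 big1 ?adde0 // => i ij.
rewrite diracE memNset ?mule0 //= => /eqP; rewrite eqr_nat eqSS => /eqP e.
by move/eqP: ij; apply; apply: val_inj.
Qed.

End six_point.

Arguments six_point : clear implicits.

(* Main.v *)
(* Send every atom j to a nearest point c j of the codebook.  Two atoms of
   masses p, q at distance d that share a point cost at least p q d^2 / (p + q),
   and this exceeds 11/192 for every pair of atoms other than {3,4}, {4,5} and
   {5,6}.  As there are only four points, two of the atoms 1, 2, 3, 5, 6 share
   one, and so do two of 1, 2, 3, 4, 6; hence c 5 = c 6 and c 3 = c 4.
   Completing the squares then determines the four points. *)
Require Import Defs.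
From mathcomp Require Import all_boot all_order all_algebra finmap.
From mathcomp Require Import all_classical all_reals all_analysis.
From mathcomp Require Import measurable_realfun ring lra.

Import Order.TTheory GRing.Theory Num.Theory.

Local Open Scope ring_scope.

Lemma cond_mean34 (R : realType) : cond_mean R 3 4 = 10 / 3.
Proof.
rewrite /cond_mean !(@big_ltn _ _ _ 3) // !(@big_ltn _ _ _ 4) // !big_geq //.
by rewrite /mass /=; field.
Qed.

Lemma cond_mean56 (R : realType) : cond_mean R 5 6 = 11 / 2.
Proof.
rewrite /cond_mean !(@big_ltn _ _ _ 5) // !(@big_ltn _ _ _ 6) // !big_geq //.
by rewrite /mass /=; field.
Qed.

(** * Distance to a codebook, and the distortion as a sum over atoms *)

Section sqdist.
Context {R : realType}.
Implicit Types (x a : R) (alpha : {fset R}).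

Lemma sqdist_ge0 x alpha : (0 <= sqdist x alpha)%E.
Proof.
rewrite /sqdist; apply: (big_rec (fun v => 0 <= v)%E) => [|a v _ v0].
  exact: leey.
by rewrite le_min lee_fin sqr_ge0.
Qed.

Lemma sqdist_le x a alpha :
  a \in alpha -> (sqdist x alpha <= ((x - a) ^+ 2)%:E)%E.
Proof.
rewrite -real_normK ?num_real // /sqdist.
rewrite -[a \in alpha]/(a \in (alpha : seq R)).
elim: (alpha : seq R) => //= b s IH; rewrite inE big_cons ge_min.
by case/predU1P => [->|/IH ->]; rewrite ?lexx ?orbT.
Qed.

Lemma sqdist_attained x alpha : (0 < #|` alpha|)%N ->
  exists2 a, a \in alpha & sqdist x alpha = ((x - a) ^+ 2)%:E.
Proof.
rewrite /sqdist.
suff attained (s : seq R) : (0 < size s)%N -> exists2 a, a \in s &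
    \big[Order.min/+oo%E]_(b <- s) (`|x - b| ^+ 2)%:E = ((x - a) ^+ 2)%:E.
  exact: attained.
elim: s => [//|b [|b' s] IH] _; rewrite big_cons real_normK ?num_real //.
  (* The induction starts from a singleton: the empty minimum is [+oo], which no point attains. *)
  by exists b; rewrite ?mem_head // big_nil min_l // leey.
have [//|a a_s ->] := IH.
case: leP => _; first by exists b; rewrite ?mem_head.
by exists a => //; rewrite inE a_s orbT.
Qed.

Lemma measurable_sqdist alpha :
  measurable_fun setT (fun x : measurableTypeR R => sqdist x alpha).
Proof.
rewrite /sqdist; elim: (alpha : seq R) => [|a s IH].
  by under eq_fun do rewrite big_nil; exact: measurable_cst.
under eq_fun do rewrite big_cons.
apply: measurable_mine => //; apply/measurable_EFinP.
apply: measurable_funX; apply: measurableT_comp => //.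
exact: measurable_funB.
Qed.

(** The integrand is nonnegative and measurable, so the integral splits over the scaled Dirac
    masses. *)
Lemma distortion_six_point alpha : distortion (six_point R) alpha =
  (\sum_(i < 6) (mass R i.+1)%:E * sqdist i.+1%:R alpha)%E.
Proof.
rewrite /distortion /six_point ge0_integral_measure_sum //; last 2 first.
- by move=> x _; exact: sqdist_ge0.
- exact: measurable_sqdist.
apply: eq_bigr => i _; rewrite ge0_integral_mscale //=; last 2 first.
- exact: measurable_sqdist.
- by move=> x _; exact: sqdist_ge0.
rewrite integral_dirac //; last exact: measurable_sqdist.
by rewrite diracT mul1e.
Qed.

End sqdist.

(** * Costs of assigning atoms to points *)

Section assignment.
Context {R : realType}.
Implicit Types (c : nat -> R) (alpha : {fset R}).

(** Here [c j] need not be nearest to [j]: any choice within a codebook bounds its distortion from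
    above, and a nearest choice attains it. *)
Definition assignment_cost c : R :=
  \sum_(i < 6) mass R i.+1 * (i.+1%:R - c i.+1) ^+ 2.

Lemma assignment_costE c : assignment_cost c =
  (1 - c 1%N) ^+ 2 / 2 + (2 - c 2%N) ^+ 2 / 4 + (3 - c 3%N) ^+ 2 / 8 +
  (4 - c 4%N) ^+ 2 / 16 + (5 - c 5%N) ^+ 2 / 32 + (6 - c 6%N) ^+ 2 / 32.
Proof.
by rewrite /assignment_cost !big_ord_recl big_ord0 /= /bump /mass /=; field.
Qed.

Lemma distortion_le_assignment c alpha : (forall j, c j \in alpha) ->
  (distortion (six_point R) alpha <= (assignment_cost c)%:E)%E.
Proof.
move=> c_alpha; rewrite distortion_six_point /assignment_cost -sumEFin.
apply: lee_sum => i _; rewrite EFinM; apply: lee_wpmul2l.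
  by rewrite lee_fin mass_ge0.
exact: sqdist_le.
Qed.

Lemma distortion_assignment alpha : (0 < #|` alpha|)%N ->
  exists2 c : nat -> R, (forall j, c j \in alpha) &
    distortion (six_point R) alpha = (assignment_cost c)%:E.
Proof.
move=> alpha0.
have near j : exists a, a \in alpha /\
    sqdist (j%:R : R) alpha = ((j%:R - a) ^+ 2)%:E.
  by have [a] := sqdist_attained j%:R alpha alpha0; exists a.
have [c cP] := choice near.
exists c => [j|]; first by case: (cP j).
rewrite distortion_six_point /assignment_cost -sumEFin.
by apply: eq_bigr => i _; rewrite (cP i.+1).2 EFinM.
Qed.

(** The gap between the two sides is a perfect square, which vanishes when [u] is the weighted mean
    of [x] and [y]. *)
Lemma two_point_cost (p q x y u : R) :
  p * q * (x - y) ^+ 2 <=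
  (p + q) * (p * (x - u) ^+ 2 + q * (y - u) ^+ 2).
Proof.
rewrite -subr_ge0 [leRHS](_ : _ = (p * (x - u) + q * (y - u)) ^+ 2) ?sqr_ge0 //.
by ring.
Qed.

Lemma shared_point_cost c (i j : nat) : (i < j < 6)%N -> c i.+1 = c j.+1 ->
  mass R i.+1 * mass R j.+1 * (i.+1%:R - j.+1%:R) ^+ 2 <=
  (mass R i.+1 + mass R j.+1) * assignment_cost c.
Proof.
move=> /andP[ij j6] cij; have i6 := ltn_trans ij j6.
apply: le_trans (two_point_cost _ _ _ _ (c i.+1)) _.
rewrite ler_wpM2l ?addr_ge0 ?mass_ge0 // {2}cij.
(* The four other atoms contribute nonnegative terms. *)
rewrite /assignment_cost (bigD1 (Ordinal i6)) //= (bigD1 (Ordinal j6)) /=.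
  rewrite addrA lerDl.
  by apply: sumr_ge0 => k _; rewrite mulr_ge0 ?mass_ge0 ?sqr_ge0.
by rewrite -val_eqE /= gtn_eqF.
Qed.

Lemma four_means_assignment c alpha : (#|` alpha| <= 4)%N ->
  (forall j, c j \in alpha) -> assignment_cost c <= 11 / 192 ->
  [/\ c 1%N = 1, c 2%N = 2, c 3%N = 10 / 3 /\ c 4%N = 10 / 3 &
      c 5%N = 11 / 2 /\ c 6%N = 11 / 2].
Proof.
move=> card_alpha c_alpha cost.
have far (i j : nat) : (i < j < 6)%N ->
    (mass R i.+1 + mass R j.+1) * (11 / 192) <
    mass R i.+1 * mass R j.+1 * (i.+1%:R - j.+1%:R) ^+ 2 ->
    (c i.+1 == c j.+1) = false.
  move=> ij; apply: contra_ltF => /eqP /(shared_point_cost c _ _ ij) le.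
  by rewrite (le_trans le) // ler_wpM2l ?addr_ge0 ?mass_ge0.
(* Among these twelve pairs the smallest two-point cost is 1/12, for {2,3} and {4,6}. *)
have n12 : (c 1%N == c 2%N) = false by apply: far; rewrite // /mass /=; lra.
have n13 : (c 1%N == c 3%N) = false by apply: far; rewrite // /mass /=; lra.
have n14 : (c 1%N == c 4%N) = false by apply: far; rewrite // /mass /=; lra.
have n15 : (c 1%N == c 5%N) = false by apply: far; rewrite // /mass /=; lra.
have n16 : (c 1%N == c 6%N) = false by apply: far; rewrite // /mass /=; lra.
have n23 : (c 2%N == c 3%N) = false by apply: far; rewrite // /mass /=; lra.
have n24 : (c 2%N == c 4%N) = false by apply: far; rewrite // /mass /=; lra.
have n25 : (c 2%N == c 5%N) = false by apply: far; rewrite // /mass /=; lra.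
have n26 : (c 2%N == c 6%N) = false by apply: far; rewrite // /mass /=; lra.
have n35 : (c 3%N == c 5%N) = false by apply: far; rewrite // /mass /=; lra.
have n36 : (c 3%N == c 6%N) = false by apply: far; rewrite // /mass /=; lra.
have n46 : (c 4%N == c 6%N) = false by apply: far; rewrite // /mass /=; lra.
have not_uniq (s : seq nat) : (4 < size s)%N -> ~~ uniq (map c s).
  move=> s4; apply/negP => /uniq_leq_size le_s.
  have /le_s : {subset map c s <= alpha} by move=> _ /mapP[j _ ->].
  by rewrite size_map leqNgt (leq_ltn_trans _ s4).
have c56 : c 5%N = c 6%N.
  (* Leaving out atom 4 rules out {3,4} and {4,5}, so only {5,6} can coincide. *)
  have := not_uniq [:: 1; 2; 3; 5; 6]%N isT.
  rewrite /= !inE n12 n13 n15 n16 n23 n25 n26 n35 n36 /= andbT negbK.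
  by move/eqP.
have c34 : c 3%N = c 4%N.
  (* Leaving out atom 5 likewise isolates {3,4}. *)
  have := not_uniq [:: 1; 2; 3; 4; 6]%N isT.
  rewrite /= !inE n12 n13 n14 n16 n23 n24 n26 n36 n46 /= orbF !andbT negbK.
  by move/eqP.
move: cost; rewrite assignment_costE -c34 -c56 => cost.
have sq_eq (x y : R) : (x - y) ^+ 2 <= 0 -> x = y.
  by move=> le0; apply/eqP; rewrite -subr_eq0 -sqrf_eq0 eq_le le0 sqr_ge0.
(* The cost is now 11/192 plus these four squares with weights 1/2, 1/4, 3/16 and 1/16, where 11/192
   = 1/24 + 1/64 comes from the pairs {3,4} and {5,6}. Hence every square is at most 0. *)
have sq1 := sqr_ge0 (c 1%N - 1).
have sq2 := sqr_ge0 (c 2%N - 2).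
have sq3 := sqr_ge0 (c 3%N - 10 / 3).
have sq5 := sqr_ge0 (c 5%N - 11 / 2).
by split; [|..|split|split]; apply: sq_eq; lra.
Qed.

(** A cost below 11/192 would already force the four optimal points, whose cost is exactly
    11/192. *)
Lemma four_means_assignment_cost c alpha : (#|` alpha| <= 4)%N ->
  (forall j, c j \in alpha) -> 11 / 192 <= assignment_cost c.
Proof.
move=> card_alpha c_alpha; rewrite leNgt; apply/negP => lt.
have [c1 c2 [c3 c4] [c5 c6]] := four_means_assignment c alpha card_alpha c_alpha (ltW lt).
by move: lt; rewrite assignment_costE c1 c2 c3 c4 c5 c6; lra.
Qed.

End assignment.

Theorem proposition3p4 (R : realType) :
  (forall alpha : {fset R},
     optimal_means (six_point R) 4 alpha <->
     alpha = [fset 1; 2; cond_mean R 3 4; cond_mean R 5 6]%fset) /\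
  quantization_error (six_point R) 4 = (11 / 192)%:E.
Proof.
rewrite cond_mean34 cond_mean56.
set opt : {fset R} := [fset 1; 2; 10 / 3; 11 / 2]%fset.
have card_opt : #|` opt| = 4%N.
  rewrite /opt -[RHS]/(size [:: 1; 2; 10 / 3; 11 / 2 : R]).
  rewrite -(@undup_id _ [:: 1; 2; 10 / 3; 11 / 2 : R]).
    rewrite -card_fseq; congr #|` _|; apply/fsetP => x.
    by rewrite !inE orbF -!orbA.
  rewrite /= !inE !negb_or -!andbA andbT.
  by rewrite !lt_eqF //; lra.
have lower (alpha : {fset R}) : codebook 4 alpha ->
    ((11 / 192)%:E <= distortion (six_point R) alpha)%E.
  move=> /andP[alpha0 alpha4].
  have [c c_alpha ->] := distortion_assignment alpha alpha0.
  by rewrite lee_fin; exact: four_means_assignment_cost c alpha alpha4 c_alpha.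
have codebook_opt : codebook 4 opt by rewrite /codebook card_opt.
have dist_opt : distortion (six_point R) opt = (11 / 192)%:E.
  apply/le_anti; rewrite lower // andbT.
  (* Atoms start at 1, so entry 0 is a filler, chosen in [opt] because every [c j] must lie there;
     the default [11 / 2] serves atoms 5 and 6. *)
  pose c := nth (11 / 2 : R) [:: 1; 1; 2; 10 / 3; 10 / 3].
  suff <- : assignment_cost c = 11 / 192.
    apply: distortion_le_assignment => j; rewrite /c !inE.
    by case: j => [|[|[|[|[|[|j]]]]]] /=; rewrite eqxx ?orbT.
  by rewrite assignment_costE /c /=; field.
have error4 : quantization_error (six_point R) 4 = (11 / 192)%:E.
  apply/le_anti/andP; split.
    by apply: ereal_inf_lbound; exists opt.
  by apply/ereal_infP => _ [alpha codebook_alpha <-]; exact: lower.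
split=> // alpha; split=> [[/andP[alpha0 alpha4]]|->]; last first.
  by split=> //; rewrite dist_opt error4.
have [c c_alpha ->] := distortion_assignment alpha alpha0.
rewrite error4 => -[cost].
have /(four_means_assignment c alpha alpha4 c_alpha) : assignment_cost c <= 11 / 192.
  by rewrite cost.
move=> [c1 c2 [c3 _] [c5 _]].
(* Since [alpha] has at most as many points as [opt], it suffices that [alpha] contains [opt], whose
   points are all values of [c]. *)
apply/esym/eqP; rewrite eqEfcard card_opt alpha4 andbT.
apply/fsubsetP => x; rewrite !inE -!orbA.
by case/or4P => /eqP->; [rewrite -c1|rewrite -c2|rewrite -c3|rewrite -c5].
Qed.
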